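(* Let $I\subset\mathbb{R}$ be an open interval, let $\Psi:I\to\mathbb{R}$ be a $C^2$ function with $\Psi_t\neq 0$ on $I$, put $h=\Psi_t^2$, and consider the invertible transformation of the independent variables $(s,t)\mapsto(x,y)$ given by $x=s$, $y=\Psi(t)$. Then the PDE system $$g_{ss}g_t h_t+2h\,(g_{st})^2-2h\,g_{ss}g_{tt}=0,$$ $$f_{ss}f_t h_t+2h\,(f_{st})^2-2h\,f_{ss}f_{tt}=0,$$ $$(g_t)^2+(f_t)^2-h=0,\qquad h_s=0$$ is obtained from the PDE system $$f_{xx}f_{yy}-(f_{xy})^2=0,\qquad g_{xx}g_{yy}-(g_{xy})^2=0,\qquad (f_y)^2+(g_y)^2-1=0$$ by this transformation of the independent variables. That is, for any open set $D\subset\mathbb{R}\times I$ with image $\hat D=\{(s,\Psi(t)):(s,t)\in D\}$ and any $C^2$ functions $\hat f,\hat g:\hat D\to\mathbb{R}$, the pair $(\hat f,\hat g)$ satisfies the second system on $\hat D$ (in the variables $(x,y)$) if and only if the functions $f(s,t)=\hat f(s,\Psi(t))$ and $g(s,t)=\hat g(s,\Psi(t))$, together with $h=\Psi_t^2$, satisfy the first system on $D$.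
   Context: Subscripts denote partial derivatives, e.g. $f_{st}=\partial_s\partial_t f$. All functions are real-valued. The function $h$ depends on $t$ only, which is what $h_s=0$ expresses. *)

(* Defs.v *)
From Stdlib Require Export Reals.
From Coquelicot Require Export Coquelicot.
Open Scope R_scope.

(* Functions given on an open set are represented by total functions of which
   only the values on that set matter: [Derive] and [partial_derive] at a point
   of an open set depend only on the values near that point.
   [partial_derive m k f s t] is the iterated derivative
   (d/ds)^m (d/dt)^k f at (s, t). *)

Definition open_interval (a b : Rbar) (t : R) : Prop :=
  Rbar_lt a t /\ Rbar_lt t b.

Definition C2_on (I : R -> Prop) (Psi : R -> R) : Prop :=
  forall (t : R) (k : nat), I t -> (k <= 2)%nat ->
    ex_derive_n Psi k t /\ continuous (Derive_n Psi k) t.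

(* On an open set, [ex_diff_n u 2] at every point says that [u] and all its
   iterated partial derivatives of order at most 2 exist and are continuous. *)
Definition C2_on_2d (D : R * R -> Prop) (u : R -> R -> R) : Prop :=
  forall x y : R, D (x, y) -> ex_diff_n u 2 x y.

Definition change_of_variables (Psi : R -> R) (p : R * R) : R * R :=
  (fst p, Psi (snd p)).

Definition image_set (phi : R * R -> R * R) (D : R * R -> Prop) :
    R * R -> Prop :=
  fun q => exists p : R * R, D p /\ phi p = q.

Definition pullback (phi : R * R -> R * R) (u : R -> R -> R) : R -> R -> R :=
  fun s t => u (fst (phi (s, t))) (snd (phi (s, t))).

Definition system_st (D : R * R -> Prop) (f g h : R -> R -> R) : Prop :=
  forall s t : R, D (s, t) ->
    let h_s  := partial_derive 1 0 h s t in
    let h_t  := partial_derive 0 1 h s t in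
    let f_t  := partial_derive 0 1 f s t in
    let f_ss := partial_derive 2 0 f s t in
    let f_st := partial_derive 1 1 f s t in
    let f_tt := partial_derive 0 2 f s t in
    let g_t  := partial_derive 0 1 g s t in
    let g_ss := partial_derive 2 0 g s t in
    let g_st := partial_derive 1 1 g s t in
    let g_tt := partial_derive 0 2 g s t in
    g_ss * g_t * h_t + 2 * h s t * g_st ^ 2 - 2 * h s t * g_ss * g_tt = 0 /\
    f_ss * f_t * h_t + 2 * h s t * f_st ^ 2 - 2 * h s t * f_ss * f_tt = 0 /\
    g_t ^ 2 + f_t ^ 2 - h s t = 0 /\
    h_s = 0.

Definition system_xy (D : R * R -> Prop) (f g : R -> R -> R) : Prop :=
  forall x y : R, D (x, y) ->
    let f_y  := partial_derive 0 1 f x y in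
    let f_xx := partial_derive 2 0 f x y in
    let f_xy := partial_derive 1 1 f x y in
    let f_yy := partial_derive 0 2 f x y in
    let g_y  := partial_derive 0 1 g x y in
    let g_xx := partial_derive 2 0 g x y in
    let g_xy := partial_derive 1 1 g x y in
    let g_yy := partial_derive 0 2 g x y in
    f_xx * f_yy - f_xy ^ 2 = 0 /\
    g_xx * g_yy - g_xy ^ 2 = 0 /\
    f_y ^ 2 + g_y ^ 2 - 1 = 0.

(* Main.v *)
Require Import Defs.
From Stdlib Require Import Lra.

(** Write [u(s, t) = uhat (s, Psi t)]. The chain rule gives, with every
    derivative of [uhat] taken at [(s, Psi t)],
    [u_t = Psi' uhat_y],  [u_ss = uhat_xx],  [u_st = Psi' uhat_xy],
    [u_tt = Psi'' uhat_y + Psi'^2 uhat_yy],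
    while [h = Psi'^2] has [h_t = 2 Psi' Psi''].  Substituting, the first-order
    terms cancel: [u_ss u_t h_t] is exactly compensated by the term
    [Psi'' uhat_y] of [u_tt], and
    [u_ss u_t h_t + 2 h u_st^2 - 2 h u_ss u_tt
       = - 2 Psi'^4 (uhat_xx uhat_yy - uhat_xy^2)].
    Likewise [g_t^2 + f_t^2 - h = Psi'^2 (fhat_y^2 + ghat_y^2 - 1)].
    As [Psi'] does not vanish, each equation of one system is equivalent to the
    corresponding equation of the other at corresponding points; [h_s = 0] holds
    for every [h] that depends on [t] alone.

    The analytic content is thus the chain rule for second derivatives
    ([partial_02_pullback], [partial_11_pullback]).  The outer derivative there
    needs the first-order formula in a neighbourhood of the point and along a
    coordinate line, which openness of [D] supplies. *)

Lemma open_slice_fst (D : R * R -> Prop) (s t : R) :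
  open D -> D (s, t) -> locally s (fun s' => D (s', t)).
Proof.
  intros HD Hst; destruct (HD _ Hst) as [e He].
  exists e; intros s' Hs'; apply He; split; [exact Hs' | apply ball_center].
Qed.

Lemma open_slice_snd (D : R * R -> Prop) (s t : R) :
  open D -> D (s, t) -> locally t (fun t' => D (s, t')).
Proof.
  intros HD Hst; destruct (HD _ Hst) as [e He].
  exists e; intros t' Ht'; apply He; split; [apply ball_center | exact Ht'].
Qed.

Lemma C2_on_ex_derive (I : R -> Prop) (Psi : R -> R) (t : R) :
  C2_on I Psi -> I t -> ex_derive Psi t.
Proof. intros H Ht; exact (proj1 (H t 1%nat Ht (le_S _ _ (le_n 1)))). Qed.

Lemma C2_on_ex_derive_Derive (I : R -> Prop) (Psi : R -> R) (t : R) :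
  C2_on I Psi -> I t -> ex_derive (Derive Psi) t.
Proof. intros H Ht; exact (proj1 (H t 2%nat Ht (le_n 2))). Qed.

Section Pullback.

Variables (I : R -> Prop) (Psi : R -> R) (D : R * R -> Prop) (u : R -> R -> R).

Hypothesis HPsi : C2_on I Psi.
Hypothesis HD : open D.
Hypothesis HDI : forall s t : R, D (s, t) -> I t.
Hypothesis Hu : C2_on_2d (image_set (change_of_variables Psi) D) u.

Let U := pullback (change_of_variables Psi) u.

Lemma image_change_of_variables (s t : R) :
  D (s, t) -> image_set (change_of_variables Psi) D (s, Psi t).
Proof. intros Hst; exists (s, t); split; [exact Hst | reflexivity]. Qed.

Lemma partial_01_pullback (s t : R) : D (s, t) ->
  partial_derive 0 1 U s t = Derive Psi t * partial_derive 0 1 u s (Psi t).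
Proof.
  intros Hst.
  destruct (Hu _ _ (image_change_of_variables _ _ Hst)) as (_ & _ & Hy & _).
  apply (Derive_comp (u s) Psi t); [exact Hy |].
  exact (C2_on_ex_derive _ _ _ HPsi (HDI _ _ Hst)).
Qed.

(** The inner factor [Derive Psi t] depends on [t] only, hence is a constant
    for the differentiation in [s]. *)
Lemma partial_11_pullback (s t : R) : D (s, t) ->
  partial_derive 1 1 U s t = Derive Psi t * partial_derive 1 1 u s (Psi t).
Proof.
  intros Hst.
  transitivity (Derive (fun x => Derive Psi t * partial_derive 0 1 u x (Psi t)) s).
  - apply Derive_ext_loc.
    apply (filter_imp (fun x => D (x, t))); [| now apply open_slice_fst].
    intros x Hx; exact (partial_01_pullback x t Hx).
  - apply Derive_scal.
Qed.

(** The product rule applied to [U_t = Psi' * u_y(s, Psi)] produces the extra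
    first-order term [Psi'' * u_y]. *)
Lemma partial_02_pullback (s t : R) : D (s, t) ->
  partial_derive 0 2 U s t =
  Derive (Derive Psi) t * partial_derive 0 1 u s (Psi t) +
  Derive Psi t ^ 2 * partial_derive 0 2 u s (Psi t).
Proof.
  intros Hst.
  destruct (Hu _ _ (image_change_of_variables _ _ Hst))
    as (_ & _ & _ & _ & _ & _ & Hyy & _).
  assert (HP1 := C2_on_ex_derive _ _ _ HPsi (HDI _ _ Hst)).
  assert (HP2 := C2_on_ex_derive_Derive _ _ _ HPsi (HDI _ _ Hst)).
  transitivity (Derive (fun y => Derive Psi y * Derive (u s) (Psi y)) t).
  - apply Derive_ext_loc.
    apply (filter_imp (fun y => D (s, y))); [| now apply open_slice_snd].
    intros y Hy; exact (partial_01_pullback s y Hy).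
  - rewrite Derive_mult.
    + rewrite (Derive_comp (Derive (u s)) Psi t Hyy HP1).
      change (partial_derive 0 1 u s (Psi t)) with (Derive (u s) (Psi t)).
      change (partial_derive 0 2 u s (Psi t)) with (Derive (Derive (u s)) (Psi t)).
      ring.
    + exact HP2.
    + exact (ex_derive_comp (Derive (u s)) Psi t Hyy HP1).
Qed.

(** The first-order terms cancel: the operator of the [(s, t)]-system is a
    multiple of the Hessian determinant of [u]. *)
Lemma monge_ampere_pullback (s t : R) : D (s, t) ->
  partial_derive 2 0 U s t * partial_derive 0 1 U s t *
    (2 * Derive Psi t * Derive (Derive Psi) t) +
  2 * Derive Psi t ^ 2 * partial_derive 1 1 U s t ^ 2 -
  2 * Derive Psi t ^ 2 * partial_derive 2 0 U s t * partial_derive 0 2 U s t =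
  - 2 * Derive Psi t ^ 4 *
  (partial_derive 2 0 u s (Psi t) * partial_derive 0 2 u s (Psi t) -
   partial_derive 1 1 u s (Psi t) ^ 2).
Proof.
  intros Hst.
  rewrite partial_01_pullback, partial_11_pullback, partial_02_pullback by exact Hst.
  change (partial_derive 2 0 U s t) with (partial_derive 2 0 u s (Psi t)).
  ring.
Qed.

End Pullback.

Lemma Derive_sqr (p : R -> R) (t : R) :
  ex_derive p t -> Derive (fun x => p x ^ 2) t = 2 * p t * Derive p t.
Proof. intros Hp; rewrite Derive_pow by exact Hp; simpl; ring. Qed.

Lemma Rmult_eq_0_iff_r (c x : R) : c <> 0 -> (c * x = 0 <-> x = 0).
Proof.
  intros Hc; split; intros H.
  - now destruct (Rmult_integral _ _ H).
  - rewrite H; ring.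
Qed.

Theorem proposition1 (a b : Rbar) (Psi : R -> R)
    (HPsi : C2_on (open_interval a b) Psi)
    (HPsi_t : forall t : R, open_interval a b t -> Derive Psi t <> 0)
    (D : R * R -> Prop) (HDopen : open D)
    (HDI : forall s t : R, D (s, t) -> open_interval a b t)
    (fhat ghat : R -> R -> R)
    (Hfhat : C2_on_2d (image_set (change_of_variables Psi) D) fhat)
    (Hghat : C2_on_2d (image_set (change_of_variables Psi) D) ghat) :
  system_xy (image_set (change_of_variables Psi) D) fhat ghat <->
  system_st D
    (pullback (change_of_variables Psi) fhat)
    (pullback (change_of_variables Psi) ghat)
    (fun _ t : R => (Derive Psi t) ^ 2).
Proof.
  set (f := pullback _ fhat); set (g := pullback _ ghat).
  assert (Hpt : forall s t, D (s, t) ->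
    (partial_derive 2 0 fhat s (Psi t) * partial_derive 0 2 fhat s (Psi t) -
       partial_derive 1 1 fhat s (Psi t) ^ 2 = 0 /\
     partial_derive 2 0 ghat s (Psi t) * partial_derive 0 2 ghat s (Psi t) -
       partial_derive 1 1 ghat s (Psi t) ^ 2 = 0 /\
     partial_derive 0 1 fhat s (Psi t) ^ 2 +
       partial_derive 0 1 ghat s (Psi t) ^ 2 - 1 = 0) <->
    (let h := fun _ t : R => (Derive Psi t) ^ 2 in
     partial_derive 2 0 g s t * partial_derive 0 1 g s t * partial_derive 0 1 h s t +
       2 * h s t * partial_derive 1 1 g s t ^ 2 -
       2 * h s t * partial_derive 2 0 g s t * partial_derive 0 2 g s t = 0 /\
     partial_derive 2 0 f s t * partial_derive 0 1 f s t * partial_derive 0 1 h s t +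
       2 * h s t * partial_derive 1 1 f s t ^ 2 -
       2 * h s t * partial_derive 2 0 f s t * partial_derive 0 2 f s t = 0 /\
     partial_derive 0 1 g s t ^ 2 + partial_derive 0 1 f s t ^ 2 - h s t = 0 /\
     partial_derive 1 0 h s t = 0)).
  { intros s t Hst; cbv zeta beta.
    assert (Ht := HDI _ _ Hst).
    assert (Hp := HPsi_t t Ht).
    assert (Hht : partial_derive 0 1 (fun _ t : R => (Derive Psi t) ^ 2) s t
                  = 2 * Derive Psi t * Derive (Derive Psi) t)
      by exact (Derive_sqr _ _ (C2_on_ex_derive_Derive _ _ _ HPsi Ht)).
    assert (Hhs : partial_derive 1 0 (fun _ t : R => (Derive Psi t) ^ 2) s t = 0)
      by exact (Derive_const (Derive Psi t ^ 2) s).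
    assert (Hnorm : partial_derive 0 1 g s t ^ 2 + partial_derive 0 1 f s t ^ 2
                      - Derive Psi t ^ 2
                    = Derive Psi t ^ 2 * (partial_derive 0 1 fhat s (Psi t) ^ 2 +
                        partial_derive 0 1 ghat s (Psi t) ^ 2 - 1)).
    { unfold f, g.
      rewrite (partial_01_pullback _ _ _ fhat HPsi HDI Hfhat _ _ Hst).
      rewrite (partial_01_pullback _ _ _ ghat HPsi HDI Hghat _ _ Hst); ring. }
    assert (Hp2 : Derive Psi t ^ 2 <> 0) by now apply pow_nonzero.
    assert (Hp4 : - 2 * Derive Psi t ^ 4 <> 0)
      by (apply Rmult_integral_contrapositive_currified;
            [lra | now apply pow_nonzero]).
    rewrite Hht, Hhs, Hnorm; unfold f, g.
    rewrite (monge_ampere_pullback _ _ _ fhat HPsi HDopen HDI Hfhat _ _ Hst).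
    rewrite (monge_ampere_pullback _ _ _ ghat HPsi HDopen HDI Hghat _ _ Hst).
    rewrite !(Rmult_eq_0_iff_r _ _ Hp4), (Rmult_eq_0_iff_r _ _ Hp2).
    tauto. }
  split.
  - intros H s t Hst.
    exact (proj1 (Hpt s t Hst) (H _ _ (image_change_of_variables _ _ _ _ Hst))).
  - intros H x y [[s t] [Hst Heq]].
    injection Heq as <- <-.
    exact (proj2 (Hpt s t Hst) (H s t Hst)).
Qed.
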